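(* The functor $\ell^2 \colon \mathbf{PInj} \to \mathbf{Hilb}$ is essentially full. That is: for every morphism $g \colon H \to K$ in $\mathbf{Hilb}$ there exist a morphism $f \colon X \to Y$ in $\mathbf{PInj}$ and bimorphisms $u \colon H \to \ell^2(X)$ and $v \colon \ell^2(Y) \to K$ of $\mathbf{Hilb}$ such that $g = v \circ \ell^2 f \circ u$.
   Context: $\mathbf{Hilb}$ is the category whose objects are complex Hilbert spaces and whose morphisms are continuous linear functions. $\mathbf{PInj}$ is the category whose objects are sets and whose morphisms $X \to Y$ are partial injections, i.e. partial functions that are injective on their domain of definition (equivalently relations $R \subseteq X \times Y$ such that each $x$ is related to at most one $y$ and each $y$ is related to at most one $x$), composed as relations. The functor $\ell^2 \colon \mathbf{PInj} \to \mathbf{Hilb}$ sends a set $X$ to $\ell^2(X) = \{\varphi \colon X \to \mathbb{C} \mid \sum_{x\in X} |\varphi(x)|^2 < \infty\}$ with inner product $\langle \varphi | \psi\rangle = \sum_{x \in X} \overline{\varphi(x)}\psi(x)$, and sends a partial injection $f \colon X \to Y$ to the linear map $\ell^2 f \colon \ell^2(X) \to \ell^2(Y)$ with $(\ell^2 f)(\varphi)(y) = \varphi(x)$ if there is a (necessarily unique) $x$ in the domain of definition of $f$ with $f(x) = y$, and $(\ell^2 f)(\varphi)(y) = 0$ otherwise. A bimorphism of a category is a morphism that is both monic and epic. For a category $\mathbf{C}$, $\mathbf{C}_{\cong}$ denotes the category with the same objects as $\mathbf{C}$ whose morphisms are the bimorphisms of $\mathbf{C}$. A functor $F \colon \mathbf{C}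 \to \mathbf{D}$ is essentially full when for each morphism $g$ in $\mathbf{D}$ there exist $f$ in $\mathbf{C}$ and $u, v$ in $\mathbf{D}_{\cong}$ such that $g = v \circ Ff \circ u$. *)

(* Defs.v *)
From HB Require Import structures.
From mathcomp Require Import all_boot all_order all_algebra finmap complex.
From mathcomp Require Import boolp classical_sets functions cardinality fsbigop.
From mathcomp Require Import reals ereal topology normedtype esum.
From mathcomp Require Import ring.
From mathcomp.analysis Require showcase.summability.

Set Implicit Arguments.
Unset Strict Implicit.
Unset Printing Implicit Defensive.

Import Order.TTheory GRing.Theory Num.Theory.
Import numFieldNormedType.Exports.

Local Open Scope classical_set_scope.
Local Open Scope ring_scope.

Local Notation Re := complex.Re.
Local Notation Im := complex.Im.
Local Notation psum := summability.partial_sum.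
Local Notation totally := summability.totally.
#[local] Existing Instance summability.totally_filter.

Lemma cvg_sum_seq (K : numFieldType) (V : normedModType K) (T J : Type)
    (F : set_system T) {FF : Filter F} (s : seq J) (g : J -> T -> V) (l : J -> V) :
  (forall j, g j @ F --> l j) ->
  (fun t => \sum_(j <- s) g j t) @ F --> \sum_(j <- s) l j.
Proof.
move=> gl; elim: s => [|j s IHs].
  by rewrite big_nil; apply: cvg_near_cst; apply: nearW => t; rewrite big_nil.
rewrite big_cons [X in X @ _](_ : _ = fun t => g j t + \sum_(j <- s) g j t).
  exact: cvgD.
by apply/funext => t; rewrite big_cons.
Qed.

Section ComplexLimits.
Variable R : realType.
Local Notation C := R[i].
Implicit Types z : C.

Lemma normc_le_ReIm z : `|z| <= (`|Re z| + `|Im z|)%:C%C.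
Proof.
rewrite {1}(complexE z) (le_trans (ler_normD _ _))//.
rewrite normrM rmorphD /= lerD //; first by rewrite normc_def /= expr0n /= addr0 sqrtr_sqr.
by rewrite !normc_def /= !expr0n /= expr1n add0r addr0 sqrtr1 mul1r sqrtr_sqr.
Qed.

Lemma Re_le_normc z : `|Re z|%:C%C <= `|z|.
Proof. exact: normc_ge_Re. Qed.

Lemma Im_le_normc z : `|Im z|%:C%C <= `|z|.
Proof.
rewrite normc_def lecR -sqrtr_sqr ler_wsqrtr // lerDr; exact: sqr_ge0.
Qed.

Lemma Re_ltc z (e : R) : `|z| < e%:C%C -> `|Re z| < e.
Proof. by move=> /(le_lt_trans (Re_le_normc _)); rewrite ltcR. Qed.

Lemma Im_ltc z (e : R) : `|z| < e%:C%C -> `|Im z| < e.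
Proof. by move=> /(le_lt_trans (Im_le_normc _)); rewrite ltcR. Qed.

Lemma cvgCP (T : Type) (F : set_system T) {FF : Filter F} (f : T -> C^o) (l : C) :
  f @ F --> (l : C^o) <->
  (Re (f t) @[t --> F] --> Re l) /\ (Im (f t) @[t --> F] --> Im l).
Proof.
split => [/cvgrPdist_lt fl | [/cvgrPdist_lt fr /cvgrPdist_lt fi]].
  split; apply/cvgrPdist_lt => e e0.
    have /fl : 0 < e%:C%C :> C by rewrite ltcR.
    apply: filterS => t /Re_ltc.
    by rewrite raddfB.
  have /fl : 0 < e%:C%C :> C by rewrite ltcR.
  apply: filterS => t /(le_lt_trans (Im_le_normc _)).
  by rewrite ltcR raddfB.
apply/cvgrPdist_lt => e e0.
have [r er] : exists r, e = r%:C%C.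
  by have /complex_realP := gtr0_real e0.
move: e0; rewrite er ltcR => r0.
have r20 : 0 < r / 2 by rewrite divr_gt0.
near=> t.
apply: (le_lt_trans (normc_le_ReIm _)); rewrite ltcR !raddfB /= [ltRHS]splitr.
apply: ltrD.
  by near: t; exact: fr.
by near: t; exact: fi.
Unshelve. all: by end_near. Qed.

Lemma cvgC_unique (T : Type) (F : set_system T) {FF : ProperFilter F}
    (f : T -> C^o) (l m : C) :
  f @ F --> (l : C^o) -> f @ F --> (m : C^o) -> l = m.
Proof. exact: (@cvg_unique C^o). Qed.

Lemma cvgC_sqnorm (T : Type) (F : set_system T) {FF : Filter F}
    (f : T -> C^o) (l : C) :
  f @ F --> (l : C^o) ->
  (fun t => `|f t| ^+ 2 : C^o) @ F --> (`|l| ^+ 2 : C^o).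
Proof.
move=> fl; have nf : (fun t => `|f t| : C^o) @ F --> (`|l| : C^o).
  exact: (@cvg_norm C C^o).
exact: (cvgM nf nf).
Qed.

Lemma cvgC_le (T : Type) (F : set_system T) {FF : ProperFilter F} (f : T -> C^o) (l M : C) :
  f @ F --> (l : C^o) -> (\forall t \near F, f t <= M) -> l <= M.
Proof.
move=> /cvgCP[fr fi] fM; rewrite lecE; apply/andP; split.
  have fc : Im (f t) @[t --> F] --> Im M.
    apply: cvg_near_cst; apply: filterS fM => t.
    by rewrite lecE => /andP[/eqP-> _].
  by apply/eqP; exact: (cvg_unique _ fc fi).
apply: (cvgr_to_le fr). apply: filterS fM => t.
by rewrite lecE => /andP[].
Qed.

Lemma cvgC_ge (T : Type) (F : set_system T) {FF : ProperFilter F} (f : T -> C^o) (l M : C) :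
  f @ F --> (l : C^o) -> (\forall t \near F, M <= f t) -> M <= l.
Proof.
move=> fl fM; rewrite -lerN2; apply: (@cvgC_le T F FF (fun t => - f t)).
  exact: (@cvgN C C^o).
by apply: filterS fM => t; rewrite lerN2.
Qed.

Lemma complex_complete (F : set_system C^o) : ProperFilter F -> cauchy F -> cvg F.
Proof.
move=> FF /cauchyP Fc.
have c1 : cauchy ((fun z : C^o => Re z) @ F).
  apply/cauchyP => e e0.
  have [|z Fz] := Fc e%:C%C; first by rewrite ltcR.
  exists (Re z); apply: (@filterS _ F _ (ball z e%:C%C)) Fz => t /Re_ltc.
  by rewrite raddfB.
have c2 : cauchy ((fun z : C^o => Im z) @ F).
  apply/cauchyP => e e0.
  have [|z Fz] := Fc e%:C%C; first by rewrite ltcR.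
  exists (Im z); apply: (@filterS _ F _ (ball z e%:C%C)) Fz => t /Im_ltc.
  by rewrite raddfB.
have : cvg ((fun z : C^o => Re z) @ F) by exact: R_complete.
move=> /cvg_ex[/= a Fa].
have : cvg ((fun z : C^o => Im z) @ F) by exact: R_complete.
move=> /cvg_ex[/= b Fb].
apply/cvg_ex; exists (a +i* b)%C.
have := (cvgCP (id : C -> C^o) (a +i* b)%C).2 (conj Fa Fb).
exact.
Qed.

End ComplexLimits.

Section AbsSum.
Variables (R : realType) (I : choiceType).
Local Notation C := R[i].

Lemma psumE (V : zmodType) (f : I -> V) (A : {fset I}) :
  psum f A = \sum_(i <- A) f i.
Proof. by rewrite /psum big_seq_fsetE. Qed.

Lemma psum_sub (V : numDomainType) (f : I -> V) (A B : {fset I}) :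
  (forall i, 0 <= f i) -> (A `<=` B)%fset -> psum f A <= psum f B.
Proof.
move=> f0 AB; rewrite !psumE.
rewrite [leRHS](big_fsetID _ (mem A)) /=.
rewrite (_ : [fset x | x in B & x \in A]%fset = A); last first.
  apply/fsetP => x; rewrite !inE /= andbC; case: (boolP (x \in A)) => //= xA.
  by rewrite (fsubsetP AB).
by rewrite lerDl sumr_ge0.
Qed.

Lemma cvg_psum_ge0 (f : I -> R) (M : R) : (forall i, 0 <= f i) ->
  (forall A, psum f A <= M) -> cvg (psum f @ totally).
Proof.
move=> f0 fM; apply/cvg_ex; exists (sup (range (psum f))).
have hs : has_sup (range (psum f)).
  split; first by exists (psum f fset0), fset0.
  by exists M => _ [A _ <-].
apply/cvgrPdist_lt => e e0.
have [_ [A _ <-] Ae] := sup_adherent e0 hs.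
exists A => //= B AB /=.
rewrite ger0_norm; last by rewrite subr_ge0; apply: sup_upper_bound => //; exists B.
by rewrite ltrBlDr -ltrBlDl (lt_le_trans Ae)// psum_sub.
Qed.

Lemma cvg_psumR (f : I -> R) (M : R) :
  (forall A, psum (fun i => `|f i|) A <= M) -> cvg (psum f @ totally).
Proof.
move=> fM.
have c1 : cvg (psum (fun i => `|f i|) @ totally) by exact: cvg_psum_ge0 fM.
have c2 : cvg (psum (fun i => f i + `|f i|) @ totally).
  apply: (@cvg_psum_ge0 _ (M + M)).
    by move=> i; have := ler_norm (- f i); rewrite normrN -subr_ge0 opprK addrC.
  move=> A; rewrite psumE big_split /= lerD //.
    by rewrite (le_trans _ (fM A))// psumE ler_sum // => i _; exact: ler_norm.
  by rewrite -psumE.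
have -> : psum f = (fun A => psum (fun i => f i + `|f i|) A - psum (fun i => `|f i|) A).
  by apply/funext => A; rewrite !psumE big_split /= addrK.
exact: is_cvgB.
Qed.

Lemma cvg_psumC (f : I -> C^o) (M : C) :
  (forall A, psum (fun i => `|f i|) A <= M) -> cvg (psum f @ totally).
Proof.
move=> fM.
have c1 : cvg (psum (fun i => Re (f i)) @ totally).
  apply: (@cvg_psumR _ (Re M)) => A.
  have := fM A; rewrite lecE => /andP[_]; apply: le_trans.
  rewrite !psumE raddf_sum ler_sum // => i _.
  by have := Re_le_normc (f i); rewrite lecE => /andP[].
have c2 : cvg (psum (fun i => Im (f i)) @ totally).
  apply: (@cvg_psumR _ (Re M)) => A.
  have := fM A; rewrite lecE => /andP[_]; apply: le_trans.
  rewrite !psumE raddf_sum ler_sum // => i _.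
  by have := Im_le_normc (f i); rewrite lecE => /andP[].
apply/cvg_ex; exists (lim (psum (fun i => Re (f i)) @ totally) +i* lim (psum (fun i => Im (f i)) @ totally))%C.
apply/cvgCP; split => /=.
  by under eq_fun do rewrite psumE raddf_sum -psumE.
by under eq_fun do rewrite psumE raddf_sum -psumE.
Qed.

End AbsSum.
(* Complex scalars are R[i] for R : realType. The norm of a normed module over
   R[i] takes values in R[i], whose order makes 0 <= z say that z is real and
   nonnegative. The inner product is conjugate-linear in its first argument;
   its positive definiteness follows from inner_norm. *)
HB.mixin Record isHilbert (R : realType) (H : Type)
    of CompleteNormedModule R[i] H := {
  inner : H -> H -> R[i];
  innerPr : forall (a : R[i]) (x y z : H),
    inner x (a *: y + z) = a * inner x y + inner x z;
  innerC : forall x y : H, inner y x = Num.conj (inner x y);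
  inner_norm : forall x : H, inner x x = `|x| ^+ 2
}.

#[short(type="hilbertType")]
HB.structure Definition Hilbert (R : realType) :=
  {H of isHilbert R H & CompleteNormedModule R[i] H}.

Lemma normC_normc (R : rcfType) (z : R[i]) :
  `|z| ^+ 2 = (Normc.normc z ^+ 2)%:C%C.
Proof. by rewrite rmorphXn. Qed.

Lemma normC_sqrD (R : realType) (u v : R[i]) :
  `|u + v| ^+ 2 <= 2 * `|u| ^+ 2 + 2 * `|v| ^+ 2.
Proof.
have h : 0 <= (`|u| - `|v|) ^+ 2 by rewrite real_exprn_even_ge0 // realB.
have : `|u + v| ^+ 2 <= (`|u| + `|v|) ^+ 2.
  by rewrite lerXn2r ?nnegrE ?addr_ge0 ?ler_normD.
move=> /le_trans; apply; rewrite -subr_ge0.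
by rewrite (_ : _ - _ = (`|u| - `|v|) ^+ 2) //; ring.
Qed.

Lemma normC_mul_le (R : realType) (u v : R[i]) :
  `|u * v| <= `|u| ^+ 2 + `|v| ^+ 2.
Proof.
have h : 0 <= (`|u| - `|v|) ^+ 2 by rewrite real_exprn_even_ge0 // realB.
rewrite normrM -subr_ge0.
rewrite (_ : _ - _ = (`|u| - `|v|) ^+ 2 + `|u| * `|v|); last by ring.
by rewrite addr_ge0 // mulr_ge0.
Qed.

Section Ell2.
Variables (R : realType) (X : Type).
Local Notation C := R[i].
Local Notation I := {classic X}.
Local Notation Q phi := (psum (fun x : I => `|phi x| ^+ 2)).

(* {classic X} is X with a choiceType structure, required by library sums. *)
Definition square_summable (phi : X -> C) : Prop :=
  esum.summable [set: {classic X}] (fun x => (Normc.normc (phi x) ^+ 2)%:E).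

Lemma square_summableP (phi : X -> C) :
  square_summable phi <-> exists M : C, forall A : {fset I}, Q phi A <= M.
Proof.
have QE A : Q phi A = (\sum_(x <- A) Normc.normc (phi x) ^+ 2)%:C%C.
  by rewrite psumE rmorph_sum; apply: eq_bigr => x _; rewrite normC_normc.
have EE (A : set I) : finite_set A ->
    \sum_(x \in A) (`| (Normc.normc (phi x) ^+ 2)%:E |)%E =
    (\sum_(x <- fset_set A) Normc.normc (phi x) ^+ 2)%:E.
  move=> fA; rewrite fsbig_finite // -sumEFin; apply: eq_bigr => x _.
  by rewrite gee0_abs // lee_fin sqr_ge0.
split=> [sphi | [M phiM]].
  rewrite /square_summable /esum.summable in sphi; set s := esum _ _ in sphi.
  have sfin : s \is a fin_num by rewrite ge0_fin_numE // esum_ge0.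
  exists (fine s)%:C%C => A; rewrite QE lecR -lee_fin fineK //.
  rewrite -[A]set_fsetK -EE //; apply: ereal_sup_ubound.
  by exists [set` A].
apply: (@le_lt_trans _ _ (Re M)%:E); last exact: ltry.
apply: ge_ereal_sup => _ [A [fA _] <-]; rewrite EE // lee_fin.
have := phiM (fset_set A); rewrite QE lecE => /andP[_].
exact.
Qed.

Definition ell2_pred : {pred X -> C} := fun phi => `[< square_summable phi >].

Lemma ell2_submod_closed : submod_closed ell2_pred.
Proof.
split=> [|a phi psi].
  apply/asboolP/square_summableP; exists 0 => A.
  by rewrite psumE big1 // => i _; rewrite normr0 expr0n.
move=> /asboolP/square_summableP[M phiM] /asboolP/square_summableP[N psiN].
apply/asboolP/square_summableP; exists (2 * (`|a| ^+ 2 * M) + 2 * N) => A.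
apply: (@le_trans _ _ (2 * (`|a| ^+ 2 * Q phi A) + 2 * Q psi A)).
  rewrite !psumE !mulr_sumr -big_split ler_sum //= => i _.
  by rewrite (le_trans (normC_sqrD _ _)) // normrM exprMn.
by rewrite lerD // ler_wpM2l // ler_wpM2l // exprn_ge0.
Qed.

Record ell2 := Ell2 { ell2_fun :> X -> C; ell2P : ell2_fun \in ell2_pred }.

HB.instance Definition _ := [isSub for ell2_fun].
HB.instance Definition _ := [Choice of ell2 by <:].
HB.instance Definition _ :=
  GRing.isSubmodClosed.Build C (X -> C) ell2_pred ell2_submod_closed.
HB.instance Definition _ := [SubChoice_isSubLmodule of ell2 by <:].

Implicit Types phi psi xi : ell2.

(* summability.sum is the limit of the net of finite partial sums. *)
Definition ell2_inner phi psi : C :=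
  summability.sum (fun x : {classic X} => Num.conj (phi x) * psi x : C^o).

Definition ell2_norm phi : C := sqrtC (ell2_inner phi phi).

Lemma ell2_eqP phi psi : (phi : X -> C) = psi -> phi = psi.
Proof. exact: val_inj. Qed.

Lemma ell2_bound phi : exists M : C, forall A : {fset I}, Q phi A <= M.
Proof. by apply/square_summableP; have /asboolP := ell2P phi. Qed.

Lemma ell2_innerP phi psi :
  psum (fun x : I => Num.conj (phi x) * psi x : C^o) @ totally --> (ell2_inner phi psi : C^o).
Proof.
have [M phiM] := ell2_bound phi; have [N psiN] := ell2_bound psi.
apply: (@cvg_psumC R I _ (M + N)) => A.
apply: (@le_trans _ _ (Q phi A + Q psi A)); last by rewrite lerD.
rewrite !psumE -big_split ler_sum //= => i _.
by rewrite (le_trans (normC_mul_le _ _)) // norm_conjC.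
Qed.
Arguments ell2_innerP : clear implicits.

Lemma ell2_innerPr (a : C) phi psi xi :
  ell2_inner phi (a *: psi + xi) = a * ell2_inner phi psi + ell2_inner phi xi.
Proof.
apply: (cvgC_unique (ell2_innerP _ _)).
have -> : psum (fun x : I => Num.conj (phi x) * (a *: psi + xi) x : C^o) =
  (fun A => a *: (psum (fun x : I => Num.conj (phi x) * psi x : C^o) A : C^o)
          + psum (fun x : I => Num.conj (phi x) * xi x : C^o) A).
  apply/funext => A; rewrite !psumE scaler_sumr -big_split /=.
  apply: eq_bigr => x _; rewrite /GRing.scale /=.
  by rewrite mulrDr mulrCA.
apply: cvgD; last exact: ell2_innerP.
by apply: cvgZr; exact: ell2_innerP.
Qed.

Lemma ell2_innerC phi psi : ell2_inner psi phi = Num.conj (ell2_inner phi psi).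
Proof.
apply: (cvgC_unique (ell2_innerP _ _)).
have -> : psum (fun x : I => Num.conj (psi x) * phi x : C^o) =
  (fun A => Num.conj (psum (fun x : I => Num.conj (phi x) * psi x : C^o) A)).
  apply/funext => A; rewrite !psumE rmorph_sum /=.
  by apply: eq_bigr => x _; rewrite rmorphM /= conjCK mulrC.
have /cvgrPdist_lt h := ell2_innerP phi psi.
apply/cvgrPdist_lt => e /h; apply: filterS => A /=.
by rewrite -rmorphB /= norm_conjC.
Qed.

Lemma ell2_innerxxP phi : Q phi @ totally --> (ell2_inner phi phi : C^o).
Proof.
have -> : Q phi = psum (fun x : I => Num.conj (phi x) * phi x : C^o).
  by apply/funext => A; rewrite !psumE; apply: eq_bigr => x _; rewrite normCKC.
exact: ell2_innerP.
Qed.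
Arguments ell2_innerxxP : clear implicits.

Lemma ell2_inner_ge phi A : Q phi A <= ell2_inner phi phi.
Proof.
apply: (cvgC_ge (ell2_innerxxP phi)); exists A => //= B AB.
by apply: psum_sub => // i; rewrite exprn_ge0.
Qed.

Lemma ell2_inner_le phi M : (forall A, Q phi A <= M) -> ell2_inner phi phi <= M.
Proof. by move=> h; apply: (cvgC_le (ell2_innerxxP phi)); exact: nearW. Qed.

Lemma ell2_inner_ge0 phi : 0 <= ell2_inner phi phi.
Proof.
by apply: le_trans (ell2_inner_ge phi fset0); rewrite psumE big_seq_fset0.
Qed.

Lemma ell2_inner_ge1 phi (x : X) : `|phi x| ^+ 2 <= ell2_inner phi phi.
Proof.
apply: le_trans (ell2_inner_ge phi [fset (x : I)]%fset).
by rewrite psumE big_seq_fset1.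
Qed.

Lemma ell2_inner_eq0 phi : ell2_inner phi phi = 0 -> phi = 0.
Proof.
move=> h; apply: ell2_eqP; apply/funext => x.
apply/eqP; rewrite -normr_eq0 -sqrf_eq0 eq_le exprn_ge0 // andbT -h.
exact: ell2_inner_ge1.
Qed.

Lemma ell2_norm_ge0 phi : 0 <= ell2_norm phi.
Proof. by rewrite sqrtC_ge0 ell2_inner_ge0. Qed.

Lemma ell2_norm_sqr phi : ell2_norm phi ^+ 2 = ell2_inner phi phi.
Proof. exact: sqrtCK. Qed.

End Ell2.

Section Ell2Norm.
Variables (R : realType) (X : Type).
Local Notation C := R[i].
Local Notation I := {classic X}.
Local Notation Q phi := (psum (fun x : I => `|phi x| ^+ 2)).
Local Notation ip := (@ell2_inner R X).
Local Notation N := (@ell2_norm R X).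
Implicit Types phi psi xi : ell2 R X.

Lemma ell2_innerDr phi psi xi : ip phi (psi + xi) = ip phi psi + ip phi xi.
Proof. by have := ell2_innerPr 1 phi psi xi; rewrite scale1r mul1r. Qed.

Lemma ell2_inner0r phi : ip phi 0 = 0.
Proof. by apply: (addrI (ip phi 0)); rewrite -ell2_innerDr !addr0. Qed.

Lemma ell2_innerZr (a : C) phi psi : ip phi (a *: psi) = a * ip phi psi.
Proof. by have := ell2_innerPr a phi psi 0; rewrite ell2_inner0r !addr0. Qed.

Lemma ell2_innerDl phi psi xi : ip (psi + xi) phi = ip psi phi + ip xi phi.
Proof.
by rewrite ell2_innerC ell2_innerDr rmorphD /= -!(ell2_innerC phi).
Qed.

Lemma ell2_innerZl (a : C) phi psi : ip (a *: phi) psi = Num.conj a * ip phi psi.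
Proof. by rewrite ell2_innerC ell2_innerZr rmorphM /= -(ell2_innerC psi). Qed.

Lemma ell2_CauchySchwarz phi psi :
  `|ip phi psi| ^+ 2 <= ip phi phi * ip psi psi.
Proof.
have [b0|b0] := eqVneq (ip psi psi) 0.
  by rewrite b0 (ell2_inner_eq0 b0) ell2_inner0r normr0 expr0n /= mulr0.
have b_gt0 : 0 < ip psi psi by rewrite lt_def b0 ell2_inner_ge0.
pose c := ip psi phi / ip psi psi; pose z := phi + (- c) *: psi.
have zpsi : ip psi z = 0.
  by rewrite ell2_innerDr ell2_innerZr mulNr divfK // subrr.
have zz : ip z z = ip phi phi - `|ip phi psi| ^+ 2 / ip psi psi.
  rewrite {2}/z ell2_innerDr ell2_innerZr (ell2_innerC psi z) zpsi conjC0.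
  rewrite mulr0 addr0 ell2_innerDl ell2_innerZl rmorphN mulNr /c rmorphM /=.
  rewrite -ell2_innerC fmorphV /= -ell2_innerC mulrAC (ell2_innerC phi psi).
  by rewrite -normCK.
have := ell2_inner_ge0 z.
by rewrite zz subr_ge0 ler_pdivrMr.
Qed.

Lemma ell2_inner_le_norm phi psi : `|ip phi psi| <= N phi * N psi.
Proof.
rewrite -(@ler_pXn2r _ 2) ?nnegrE ?mulr_ge0 ?ell2_norm_ge0 //.
by rewrite exprMn !ell2_norm_sqr ell2_CauchySchwarz.
Qed.

Lemma ell2_normD phi psi : N (phi + psi) <= N phi + N psi.
Proof.
rewrite -(@ler_pXn2r _ 2) ?nnegrE ?addr_ge0 ?ell2_norm_ge0 //.
rewrite sqrrD !ell2_norm_sqr ell2_innerDr !ell2_innerDl.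
rewrite addrA lerD2r -addrA lerD2l.
have rl : ip psi phi + ip phi psi \is Num.real.
  by apply/CrealP; rewrite rmorphD /= -!ell2_innerC addrC.
apply: (le_trans (real_ler_norm rl)); apply: (le_trans (ler_normD _ _)).
rewrite mulr2n lerD //; last exact: ell2_inner_le_norm.
by rewrite mulrC ell2_inner_le_norm.
Qed.

Lemma ell2_normZ (a : C) phi : N (a *: phi) = `|a| * N phi.
Proof.
rewrite /ell2_norm ell2_innerZr ell2_innerZl mulrA -normCK.
rewrite sqrtCM ?nnegrE ?exprn_ge0 ?ell2_inner_ge0 //.
by rewrite sqrCK.
Qed.

Lemma ell2_norm_eq0 phi : N phi = 0 -> phi = 0.
Proof.
by move=> h; apply: ell2_inner_eq0; rewrite -ell2_norm_sqr h expr0n.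
Qed.

HB.instance Definition _ := Lmodule_isNormed.Build C (ell2 R X)
  ell2_normD ell2_normZ ell2_norm_eq0.

Lemma ell2_normE phi : `|phi| = N phi.
Proof. by []. Qed.

Lemma ell2_eval_le phi (x : X) : `|phi x| <= `|phi|.
Proof.
rewrite -(@ler_pXn2r _ 2) ?nnegrE // ell2_normE ell2_norm_sqr.
exact: ell2_inner_ge1.
Qed.

Lemma ell2_complete (F : set_system (ell2 R X)) :
  ProperFilter F -> cauchy F -> cvg F.
Proof.
move=> FF /cauchyP Fc.
have ev x : cvg ((fun phi : ell2 R X => phi x : C^o) @ F).
  apply: complex_complete; apply/cauchyP => e e0.
  have [phi Fphi] := Fc e e0; exists (phi x).
  apply: (@filterS _ F _ (ball phi e)) Fphi => psi.
  rewrite -ball_normE /= => /(le_lt_trans _); apply.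
  exact: (ell2_eval_le (phi - psi)).
pose l (x : X) : C := lim ((fun phi : ell2 R X => phi x : C^o) @ F).
have key phi (e : C) : F (ball phi e) -> forall A,
    Q (fun x => phi x - l x) A <= e ^+ 2.
  move=> Fphi A.
  apply: (@cvgC_le R _ F _ (fun psi => Q (fun x => phi x - psi x) A : C^o)).
    rewrite psumE [X in X @ _](_ : _ = fun psi : ell2 R X =>
        (\sum_(x <- A) `|phi x - psi x| ^+ 2 : C^o)); last first.
      by apply/funext => psi; rewrite psumE.
    apply: (cvg_sum_seq (V := C^o)) => x; apply: cvgC_sqnorm.
    by apply: (@cvgB C C^o); [exact: cvg_cst|exact: ev].
  apply: (@filterS _ F _ (ball phi e)) Fphi => psi.
  rewrite -ball_normE /= => phipsi.
  apply: (le_trans (ell2_inner_ge (phi - psi) A)).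
  rewrite -ell2_norm_sqr lerXn2r ?nnegrE ?ell2_norm_ge0 ?ltW //.
  by apply: le_lt_trans phipsi; exact: normr_ge0.
have lP : l \in @ell2_pred R X.
  have [phi Fphi] := Fc 1 ltr01.
  have d : (fun x => phi x - l x) \in @ell2_pred R X.
    by apply/asboolP/square_summableP; exists (1 ^+ 2); exact: key.
  have -> : l = (phi : X -> C) - (fun x => phi x - l x).
    by apply/funext => x; rewrite !fctE subKr.
  by apply: rpredB => //; exact: ell2P.
pose L := Ell2 lP.
apply/cvg_ex; exists L; apply/cvgrPdist_lt => e e0.
have e20 : 0 < e / 2 by rewrite divr_gt0.
have [phi Fphi] := Fc _ e20.
apply: (@filterS _ F _ (ball phi (e / 2))) (Fphi) => psi.
rewrite -ball_normE /= => phipsi.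
have Lphi : `|L - phi| <= e / 2.
  rewrite distrC -(@ler_pXn2r _ 2) ?nnegrE ?(ltW e20) // ell2_normE ell2_norm_sqr.
  by apply: ell2_inner_le; exact: key Fphi.
have -> : L - psi = (L - phi) + (phi - psi) by rewrite addrA subrK.
rewrite [ltRHS]splitr (le_lt_trans (ler_normD _ _)) //.
exact: ler_ltD.
Qed.

HB.instance Definition _ := Uniform_isComplete.Build (ell2 R X) ell2_complete.

Lemma ell2_inner_norm phi : ip phi phi = `|phi| ^+ 2.
Proof. by rewrite ell2_normE ell2_norm_sqr. Qed.

HB.instance Definition _ := isHilbert.Build R (ell2 R X)
  (@ell2_innerPr R X) (@ell2_innerC R X) ell2_inner_norm.

End Ell2Norm.

Section PartialInjections.

(* A partial injection is given by its graph, composition being that of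
   relations. *)
Record pinj (X Y : Type) := Pinj {
  pinj_rel :> X -> Y -> Prop;
  pinj_functional : forall x y y',
    pinj_rel x y -> pinj_rel x y' -> y = y';
  pinj_injective : forall x x' y,
    pinj_rel x y -> pinj_rel x' y -> x = x' }.

Lemma pinj_ext (X Y : Type) (f g : pinj X Y) :
  (forall x y, f x y <-> g x y) -> f = g.
Proof.
case: f g => [f f1 f2] [g g1 g2] /= fg.
have e : f = g by apply/funext => x; apply/funext => y; apply/propext.
by subst g; congr Pinj; exact: Prop_irrelevance.
Qed.

Program Definition pinj_id (X : Type) : pinj X X := @Pinj X X eq _ _.
Next Obligation. by move=> X x y y' <- <-. Qed.
Next Obligation. by move=> X x x' y -> ->. Qed.

Program Definition pinj_comp (X Y Z : Type) (g : pinj Y Z) (f : pinj X Y) :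
  pinj X Z := @Pinj X Z (fun x z => exists y, f x y /\ g y z) _ _.
Next Obligation.
move=> X Y Z g f x z z' [y [xy yz]] [y' [xy' yz']].
by apply: (pinj_functional yz); rewrite (pinj_functional xy xy').
Qed.
Next Obligation.
move=> X Y Z g f x x' z [y [xy yz]] [y' [xy' yz']].
by apply: (pinj_injective xy); rewrite (pinj_injective yz yz').
Qed.

Lemma pinj_compA (W X Y Z : Type) (h : pinj Y Z) (g : pinj X Y) (f : pinj W X) :
  pinj_comp h (pinj_comp g f) = pinj_comp (pinj_comp h g) f.
Proof.
apply: pinj_ext => w z; split => [[y [[x [? ?]] ?]] | [x [? [y [? ?]]]]].
  by exists x; split => //; exists y.
by exists y; split => //; exists x.
Qed.

Lemma pinj_comp1f (X Y : Type) (f : pinj X Y) : pinj_comp (pinj_id Y) f = f.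
Proof.
apply: pinj_ext => x y; split=> [[y' [? <-]] // | ?].
by exists y.
Qed.

Lemma pinj_compf1 (X Y : Type) (f : pinj X Y) : pinj_comp f (pinj_id X) = f.
Proof.
apply: pinj_ext => x y; split=> [[y' [<- ?]] // | ?].
by exists x.
Qed.

End PartialInjections.

Section HilbertMorphisms.
Variable R : realType.

Record hilb_hom (H K : hilbertType R) := HilbHom {
  hilb_fun :> H -> K;
  hilb_linear : linear hilb_fun;
  hilb_continuous : continuous hilb_fun }.

Lemma hilb_ext (H K : hilbertType R) (f g : hilb_hom H K) :
  (forall x, f x = g x) -> f = g.
Proof.
case: f g => [f f1 f2] [g g1 g2] /= /funext e.
by subst g; congr HilbHom; exact: Prop_irrelevance.
Qed.

Program Definition hilb_id (H : hilbertType R) : hilb_hom H H :=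
  @HilbHom H H id _ _.
Next Obligation. by []. Qed.
Next Obligation. by move=> H x; exact: cvg_id. Qed.

Program Definition hilb_comp (H K L : hilbertType R)
    (g : hilb_hom K L) (f : hilb_hom H K) : hilb_hom H L :=
  @HilbHom H L (g \o f) _ _.
Next Obligation. by move=> H K L g f a x y /=; rewrite !hilb_linear. Qed.
Next Obligation.
move=> H K L g f x.
by apply: continuous_comp; exact: hilb_continuous.
Qed.

End HilbertMorphisms.

Record category := Category {
  obj :> Type;
  mor : obj -> obj -> Type;
  idc : forall A, mor A A;
  compc : forall A B C, mor B C -> mor A B -> mor A C;
  compcA : forall A B C D (h : mor C D) (g : mor B C) (f : mor A B),
    compc h (compc g f) = compc (compc h g) f;
  compc1f : forall A B (f : mor A B), compc (idc B) f = f;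
  compcf1 : forall A B (f : mor A B), compc f (idc A) = f }.

Arguments mor {c} _ _.
Arguments idc {c} _.
Arguments compc {c A B C} _ _.

Record functor (C D : category) := Functor {
  fobj :> C -> D;
  fmap : forall A B, mor A B -> mor (fobj A) (fobj B);
  fmap_id : forall A, fmap (idc A) = idc (fobj A);
  fmap_comp : forall A B E (g : mor B E) (f : mor A B),
    fmap (compc g f) = compc (fmap g) (fmap f) }.

Arguments fmap {C D} f0 {A B} _.

Definition monic (C : category) (A B : C) (f : mor A B) : Prop :=
  forall (Z : C) (g h : mor Z A), compc f g = compc f h -> g = h.

Definition epic (C : category) (A B : C) (f : mor A B) : Prop :=
  forall (Z : C) (g h : mor B Z), compc g f = compc h f -> g = h.

Definition bimorphism (C : category) (A B : C) (f : mor A B) : Prop :=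
  monic f /\ epic f.

Definition essentially_full (C D : category) (F : functor C D) : Prop :=
  forall (A B : D) (g : mor A B),
  exists (X Y : C) (f : mor X Y) (u : mor A (F X)) (v : mor (F Y) B),
    [/\ bimorphism u, bimorphism v & g = compc v (compc (fmap F f) u)].

Definition PInj : category :=
  @Category Type pinj pinj_id pinj_comp pinj_compA pinj_comp1f pinj_compf1.

Program Definition Hilb (R : realType) : category :=
  @Category (hilbertType R) (@hilb_hom R) (@hilb_id R) (@hilb_comp R) _ _ _.
Next Obligation. by move=> R A B C D h g f; exact: hilb_ext. Qed.
Next Obligation. by move=> R A B f; exact: hilb_ext. Qed.
Next Obligation. by move=> R A B f; exact: hilb_ext. Qed.

Lemma linear_contractive_continuous (K : numFieldType) (V W : normedModType K)
    (f : V -> W) :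
  linear f -> (forall x, `|f x| <= `|x|) -> continuous f.
Proof.
move=> flin fle x; apply/cvgrPdist_lt => e e0.
apply: (@filterS _ (nbhs x) _ (ball x e)) (nbhsx_ballx x e e0) => y.
rewrite -ball_normE /=; apply: le_lt_trans.
have -> : f x - f y = f (x - y).
  by have := flin (-1) y x; rewrite !scaleN1r ![- _ + _]addrC.
exact: fle.
Qed.

Section Ell2Map.
Variables (R : realType).
Local Notation C := R[i].

Definition ell2_map_fun (X Y : Type) (f : pinj X Y) (phi : X -> C) (y : Y) : C :=
  if pselect (exists x, f x y) is left h then phi (sval (cid h)) else 0.

Lemma ell2_map_fun_in (X Y : Type) (f : pinj X Y) (phi : X -> C) x y :
  f x y -> ell2_map_fun f phi y = phi x.
Proof.
move=> fxy; rewrite /ell2_map_fun; case: pselect => [h|]; last by case; exists x.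
by rewrite (pinj_injective (svalP (cid h)) fxy).
Qed.

Lemma ell2_map_fun_notin (X Y : Type) (f : pinj X Y) (phi : X -> C) y :
  (forall x, ~ f x y) -> ell2_map_fun f phi y = 0.
Proof.
by move=> nf; rewrite /ell2_map_fun; case: pselect => // h; exfalso; case: h => x /nf.
Qed.

Lemma ell2_map_fun_linear (X Y : Type) (f : pinj X Y) (a : C) (phi psi : X -> C) y :
  ell2_map_fun f (fun x => a * phi x + psi x) y =
  a * ell2_map_fun f phi y + ell2_map_fun f psi y.
Proof.
by rewrite /ell2_map_fun; case: pselect => // _; rewrite mulr0 addr0.
Qed.

Lemma ell2_map_bound (X Y : Type) (f : pinj X Y) (phi : ell2 R X)
    (A : {fset {classic Y}}) :
  psum (fun y : {classic Y} => `|ell2_map_fun f phi y| ^+ 2) A <= ell2_inner phi phi.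
Proof.
pose pre (y : {classic Y}) : option {classic X} :=
  if pselect (exists x, f x y) is left h then Some (sval (cid h)) else None.
have preP y x : pre y = Some x -> f x y.
  by rewrite /pre; case: pselect => // h [<-]; exact: svalP (cid h).
have usub (s : seq {classic Y}) : uniq s -> uniq (pmap pre s).
  elim: s => //= y s IHs /andP[ys us]; case e: (pre y) => [x|] /=; last exact: IHs.
  rewrite IHs // andbT; apply/negP; rewrite mem_pmap => /mapP[y' y's e'].
  have yy' : y = y' by apply: (pinj_functional (preP _ _ e)); apply: preP.
  by rewrite yy' y's in ys.
have -> : psum (fun y : {classic Y} => `|ell2_map_fun f phi y| ^+ 2) A =
    \sum_(x <- pmap pre A) `|phi x| ^+ 2.
  rewrite psumE big_pmap; apply: eq_bigr => y _.
  by rewrite /ell2_map_fun /pre; case: pselect => //= _; rewrite normr0 expr0n.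
have pe : perm_eq (pmap pre A) [fset x in pmap pre A]%fset.
  apply: uniq_perm; [exact/usub/fset_uniq|exact: fset_uniq|].
  by move=> x; rewrite !inE.
by rewrite (perm_big _ pe) /= -psumE ell2_inner_ge.
Qed.

Lemma ell2_map_subproof (X Y : Type) (f : pinj X Y) (phi : ell2 R X) :
  ell2_map_fun f phi \in @ell2_pred R Y.
Proof.
apply/asboolP/square_summableP; exists (ell2_inner phi phi).
exact: ell2_map_bound.
Qed.

Definition ell2_map (X Y : Type) (f : pinj X Y) (phi : ell2 R X) : ell2 R Y :=
  Ell2 (ell2_map_subproof f phi).

Lemma ell2_map_linear (X Y : Type) (f : pinj X Y) : linear (ell2_map f).
Proof.
move=> a phi psi; apply: ell2_eqP; apply/funext => y.
exact: ell2_map_fun_linear.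
Qed.

Lemma ell2_map_norm (X Y : Type) (f : pinj X Y) (phi : ell2 R X) :
  `|ell2_map f phi| <= `|phi|.
Proof.
rewrite -(@ler_pXn2r _ 2) ?nnegrE // -!ell2_inner_norm.
by apply: ell2_inner_le => A; exact: ell2_map_bound.
Qed.

Lemma ell2_map_continuous (X Y : Type) (f : pinj X Y) : continuous (ell2_map f).
Proof.
exact: linear_contractive_continuous (ell2_map_linear f) (ell2_map_norm f).
Qed.

Definition ell2_hom (X Y : Type) (f : pinj X Y) : hilb_hom (ell2 R X) (ell2 R Y) :=
  HilbHom (ell2_map_linear f) (@ell2_map_continuous X Y f).

Lemma ell2_hom_id (X : Type) : ell2_hom (pinj_id X) = hilb_id (ell2 R X).
Proof.
apply: hilb_ext => phi; apply: ell2_eqP; apply/funext => x.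
exact: ell2_map_fun_in.
Qed.

Lemma ell2_hom_comp (X Y Z : Type) (g : pinj Y Z) (f : pinj X Y) :
  ell2_hom (pinj_comp g f) = hilb_comp (ell2_hom g) (ell2_hom f).
Proof.
apply: hilb_ext => phi; apply: ell2_eqP; apply/funext => z /=.
have [[y gyz]|ng] := pselect (exists y, g y z); last first.
  rewrite !ell2_map_fun_notin // => [y gy|x [y [_ gy]]]; by apply: ng; exists y.
rewrite (ell2_map_fun_in _ gyz) /=.
have [[x fxy]|nf] := pselect (exists x, f x y); last first.
  rewrite !ell2_map_fun_notin // => [x fx|x [y' [fx gy]]]; apply: nf; exists x => //.
  by rewrite (pinj_injective gyz gy).
rewrite (ell2_map_fun_in _ fxy); apply: ell2_map_fun_in.
by exists y.
Qed.

End Ell2Map.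

Definition ell2_functor (R : realType) : functor PInj (Hilb R) :=
  @Functor PInj (Hilb R) (fun X : Type => ell2 R X) (@ell2_hom R)
    (@ell2_hom_id R) (@ell2_hom_comp R).

(* Main.v *)
Require Import Defs.
From mathcomp Require Import all_boot all_order all_algebra finmap complex.
From mathcomp Require Import boolp classical_sets functions.
From mathcomp Require Import reals topology normedtype.
From mathcomp.analysis Require showcase.summability.

(** A continuous linear map [g : H -> K] is, up to the kernel [N] of [g] in its
    domain and the orthogonal complement of its range in its codomain, the
    injective map with dense range from the complement of [N] to the closure of
    the range of [g]. Such a map is a bimorphism, and it can be absorbed into
    [v]; what is left to the partial injection is only to forget [N] and to
    leave room for the complement of the range.

    Precisely, let [eA], [eB], [eD] be orthonormal bases of [N], of its
    orthogonal complement, and of the orthogonal complement of the range of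
    [g], indexed by [A], [B], [D]. Take
    - [u : H -> ell2 (A + B)], the coordinates with respect to [eA] and [eB]
      ([analysis]);
    - [f : A + B -> B + D], the partial injection that is the identity on [B]
      and undefined on [A] ([middle_pinj]);
    - [v : ell2 (B + D) -> K], sending the basis vector of [b] to [g (eB b)]
      and that of [d] to [eD d] ([assemble]).
    Both [g] and the composite kill [eA a] and send [eB b] to [g (eB b)], so
    they are equal ([assemble_factor]). The map [u] is injective and onto. The
    two summands of [v phi] are orthogonal, so both vanish if [v phi] does; then
    the coordinates of [phi] on [D] are zero, and those on [B] are the
    coordinates of a vector of [N] orthogonal to [N] ([assemble_monic]). The
    range of [v] contains the range of [g] and an orthonormal basis of its
    orthogonal complement, so only [0] is orthogonal to it ([assemble_epic]).

    The Hilbert space theory behind this is that every closed subspace has an orthonormal basis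
    ([maximal_orthonormal]), that square-summable coefficients can be summed
    against an orthonormal family ([synthesis]), and that a closed subspace with
    zero orthogonal complement is the whole space ([closed_subspace_full]). The
    last fact gives [hilb_eq_total]: continuous linear maps that agree on a
    family to which only [0] is orthogonal are equal. *)

Set Implicit Arguments.
Unset Strict Implicit.
Unset Printing Implicit Defensive.

Import Order.TTheory GRing.Theory Num.Theory.
Import numFieldNormedType.Exports.

Local Open Scope classical_set_scope.
Local Open Scope ring_scope.

Local Notation psum := summability.partial_sum.
Local Notation totally := summability.totally.
#[local] Existing Instance summability.totally_filter.

(** * Inner products *)

Lemma closed_equalizer (K : numFieldType) (T : topologicalType)
    (V : normedModType K) (f g : T -> V) :
  continuous f -> continuous g -> closed [set x | f x = g x].
Proof.
move=> cf cg; rewrite (_ : [set x | f x = g x] = (f - g) @^-1` [set 0]).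
  apply: preimage_closed => [x _|]; first by apply: cvgB; [exact: cf|exact: cg].
  exact/accessible_closed_set1/hausdorff_accessible/norm_hausdorff.
apply/seteqP; split=> x /=; rewrite fctE; first by move->; rewrite subrr.
by move/eqP; rewrite subr_eq0 => /eqP.
Qed.

Section InnerProduct.
Variables (R : realType) (H : hilbertType R).
Local Notation C := R[i].
Implicit Types x y z : H.

Lemma innerDr x y z : inner x (y + z) = inner x y + inner x z.
Proof. by have := innerPr 1 x y z; rewrite scale1r mul1r. Qed.

Lemma inner0r x : inner x 0 = 0.
Proof. by apply: (addrI (inner x 0)); rewrite -innerDr !addr0. Qed.

Lemma innerZr (a : C) x y : inner x (a *: y) = a * inner x y.
Proof. by have := innerPr a x y 0; rewrite inner0r !addr0. Qed.

Lemma innerBr x y z : inner x (y - z) = inner x y - inner x z.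
Proof. by rewrite -scaleN1r innerDr innerZr mulN1r. Qed.

Lemma inner_sumr (I : Type) (s : seq I) (h : I -> H) x :
  inner x (\sum_(i <- s) h i) = \sum_(i <- s) inner x (h i).
Proof.
elim: s => [|i s IHs]; first by rewrite !big_nil inner0r.
by rewrite !big_cons innerDr IHs.
Qed.

Lemma innerZl (a : C) x y : inner (a *: x) y = Num.conj a * inner x y.
Proof. by rewrite innerC innerZr rmorphM /= -innerC. Qed.

Lemma inner_suml (I : Type) (s : seq I) (h : I -> H) x :
  inner (\sum_(i <- s) h i) x = \sum_(i <- s) inner (h i) x.
Proof.
by rewrite innerC inner_sumr rmorph_sum; apply: eq_bigr => i _ /=; rewrite -innerC.
Qed.

Lemma inner_eq0C x y : inner x y = 0 -> inner y x = 0.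
Proof. by move=> xy; rewrite innerC xy conjC0. Qed.

Lemma inner_eq0 x : inner x x = 0 -> x = 0.
Proof.
by move/eqP; rewrite inner_norm sqrf_eq0 normr_eq0 => /eqP.
Qed.

Lemma normD_sqr_orthogonal x y :
  inner x y = 0 -> `|x + y| ^+ 2 = `|x| ^+ 2 + `|y| ^+ 2.
Proof.
move=> xy; rewrite -!inner_norm innerDr ![inner (x + y) _]innerC !innerDr xy.
by rewrite (inner_eq0C xy) addr0 add0r -!innerC.
Qed.

(** Cauchy-Schwarz: Pythagoras for the decomposition of [y] into its projection
    on the line of [x] and the rest. *)
Lemma inner_le_norm x y : `|inner x y| <= `|x| * `|y|.
Proof.
have [->|x0] := eqVneq x 0.
  by rewrite innerC inner0r conjC0 normr0 normr0 mul0r.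
have nx0 : 0 < `|x| ^+ 2 by rewrite exprn_gt0 // normr_gt0.
pose p := (inner x y / `|x| ^+ 2) *: x.
have px : inner p (y - p) = 0.
  by rewrite innerZl innerBr innerZr inner_norm divfK ?subrr ?mulr0 // gt_eqF.
have := normD_sqr_orthogonal px; rewrite addrCA subrr addr0 => ny.
rewrite -(@ler_pXn2r _ 2) ?nnegrE ?mulr_ge0 // exprMn ny.
have -> : `|p| ^+ 2 = `|inner x y| ^+ 2 / `|x| ^+ 2.
  rewrite normrZ exprMn normrM normrV ?unitfE ?gt_eqF // (ger0_norm (ltW nx0)).
  rewrite exprMn -mulrA; congr (_ * _).
  by rewrite [_^-1 ^+ 2]expr2 -mulrA mulVf ?mulr1 // gt_eqF.
rewrite mulrDr mulrCA divff ?gt_eqF // mulr1 lerDl.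
by rewrite mulr_ge0 ?exprn_ge0.
Qed.

Lemma continuous_inner x : continuous (inner x : H -> C^o).
Proof.
move=> y; apply/cvgrPdist_lt => e e0.
(* Dividing by the norm of x plus 1 keeps the radius defined when x = 0. *)
have x0 : 0 < `|x| + 1 by rewrite ltr_wpDl.
have ex0 : 0 < e / (`|x| + 1) by rewrite divr_gt0.
apply: (@filterS _ (nbhs y) _ (ball y (e / (`|x| + 1))))
  (nbhsx_ballx y _ ex0) => z.
rewrite -ball_normE /= ltr_pdivlMr // => yz.
rewrite -innerBr (le_lt_trans (inner_le_norm _ _)) // (le_lt_trans _ yz) //.
by rewrite mulrC ler_wpM2l // lerDl.
Qed.

End InnerProduct.

Section Orthocomplement.
Variables (R : realType) (H : hilbertType R).
Local Notation C := R[i].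

Definition closed_subspace (M : set H) : Prop :=
  [/\ M 0, forall (a : C) x y, M x -> M y -> M (a *: x + y) & closed M].

Definition orthocomplement (S : set H) : set H :=
  [set y | forall x, S x -> inner x y = 0].

Lemma closed_subspace_orthocomplement S : closed_subspace (orthocomplement S).
Proof.
split=> [x _|a y z Sy Sz x Sx|]; first exact: inner0r.
  by rewrite innerPr Sy // Sz // mulr0 addr0.
rewrite (_ : orthocomplement S =
    \bigcap_(x in S) [set y | (inner x y : C^o) = 0]) //.
apply: closed_bigI => x _.
by apply: (@closed_equalizer C H C^o _ (cst 0));
  [exact: continuous_inner|exact: cst_continuous].
Qed.

End Orthocomplement.

(** * Coordinates with respect to an orthonormal family *)

Section Orthonormal.
Variables (R : realType) (H : hilbertType R) (X : Type) (e : X -> H).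
Local Notation C := R[i].
Local Notation I := {classic X}.
Local Notation combination a := (psum (fun x : I => a x *: e x)).

Definition orthonormal : Prop :=
  (forall x, inner (e x) (e x) = 1) /\
  (forall x y, x <> y -> inner (e x) (e y) = 0).

Hypothesis oe : orthonormal.

Lemma inner_combination (a : X -> C) (A : {fset I}) (x : I) :
  x \in A -> inner (e x) (combination a A) = a x.
Proof.
have [e1 e0] := oe => xA; rewrite psumE inner_sumr (big_fsetD1 x) //=.
rewrite innerZr e1 mulr1 big_seq big1 ?addr0 // => y.
by rewrite !inE innerZr => /andP[/eqP yx _]; rewrite e0 ?mulr0 // => xy; apply: yx.
Qed.

Lemma inner_combination_eq0 (a : X -> C) (A : {fset I}) (z : H) :
  (forall x : I, x \in A -> inner (e x) z = 0) -> inner (combination a A) z = 0.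
Proof.
move=> ez; rewrite psumE inner_suml big_seq big1 // => x xA.
by rewrite innerZl ez // mulr0.
Qed.

Lemma norm_combination (a : X -> C) (A : {fset I}) :
  `|combination a A| ^+ 2 = psum (fun x : I => `|a x| ^+ 2) A.
Proof.
rewrite -inner_norm {1}psumE inner_suml [RHS]psumE big_seq [RHS]big_seq.
by apply: eq_bigr => x xA; rewrite innerZl inner_combination // normCKC.
Qed.

(** The partial Fourier sum [p] is orthogonal to [h - p], so its norm is at most
    that of [h]. *)
Lemma Bessel (h : H) (A : {fset I}) :
  psum (fun x : I => `|inner (e x) h| ^+ 2) A <= `|h| ^+ 2.
Proof.
pose p := combination (fun x => inner (e x) h) A.
have ph : inner p (h - p) = 0.
  apply: inner_combination_eq0 => x xA.
  by rewrite innerBr inner_combination // subrr.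
rewrite -norm_combination -/p -[in leRHS](subrK p h) [h - p + p]addrC.
by rewrite normD_sqr_orthogonal // lerDl exprn_ge0.
Qed.

Lemma analysis_subproof (h : H) : (fun x => inner (e x) h) \in @ell2_pred R X.
Proof.
by apply/asboolP/square_summableP; exists (`|h| ^+ 2); exact: Bessel.
Qed.

Definition analysis_fun (h : H) : ell2 R X := Ell2 (analysis_subproof h).

Lemma analysis_linear : linear analysis_fun.
Proof.
move=> a h k; apply: ell2_eqP; apply/funext => x.
exact: innerPr.
Qed.

Lemma analysis_norm h : `|analysis_fun h| <= `|h|.
Proof.
rewrite -(@ler_pXn2r _ 2) ?nnegrE // -ell2_inner_norm.
by apply: ell2_inner_le; exact: Bessel.
Qed.

Definition analysis : hilb_hom H (ell2 R X) :=
  HilbHom analysis_linear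
    (linear_contractive_continuous analysis_linear analysis_norm).

(** By Pythagoras, for [A] included in [B] the square of the distance between the
    partial sums over [A] and [B] is the difference of the partial sums of the
    squared moduli of the coefficients, and these converge. *)
Lemma combination_cauchy (phi : ell2 R X) : cauchy (combination phi @ totally).
Proof.
apply/cauchyP => r r0.
have r20 : 0 < r ^+ 2 by rewrite exprn_gt0.
have /(@cvgrPdist_lt C C^o) cQ :
    (psum (fun x : I => `|phi x| ^+ 2) : _ -> C^o) @ totally -->
    (ell2_inner phi phi : C^o).
  exact: ell2_innerxxP.
have [A _ Ar] := cQ _ r20.
exists (combination phi A), A => //= B AB; rewrite -ball_normE /= distrC.
have AP : inner (combination phi A) (combination phi B - combination phi A) = 0.
  apply: inner_combination_eq0 => x xA; rewrite innerBr !inner_combination ?subrr //.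
  exact: (fsubsetP AB).
rewrite -(@ltr_pXn2r _ 2) ?nnegrE ?(ltW r0) //.
have /= := Ar A (fsubset_refl A).
rewrite ger0_norm ?subr_ge0 ?ell2_inner_ge // => /le_lt_trans; apply.
rewrite lerBrDl -norm_combination -normD_sqr_orthogonal // addrCA subrr addr0.
by rewrite norm_combination ell2_inner_ge.
Qed.

Definition synthesis_fun (phi : ell2 R X) : H :=
  summability.sum (fun x : I => phi x *: e x).

Lemma synthesisP (phi : ell2 R X) :
  combination phi @ totally --> synthesis_fun phi.
Proof.
apply: (@cauchy_cvg H); exact: combination_cauchy.
Qed.

Lemma synthesis_linear : linear synthesis_fun.
Proof.
move=> a phi psi; set xi : ell2 R X := a *: phi + psi.
apply: (@norm_cvg_unique C H (combination xi @ totally)); first exact: synthesisP.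
have -> : combination xi =
    (fun A => a *: combination phi A + combination psi A).
  apply/funext => A; rewrite !psumE scaler_sumr -big_split /=.
  by apply: eq_bigr => x _; rewrite scalerA -scalerDl.
by apply: cvgD; [apply: cvgZr|]; exact: synthesisP.
Qed.

Lemma synthesis_norm phi : `|synthesis_fun phi| <= `|phi|.
Proof.
rewrite -(@ler_pXn2r _ 2) ?nnegrE // -ell2_inner_norm.
have nP : (fun A => `|combination phi A| : C^o) @ totally -->
    (`|synthesis_fun phi| : C^o).
  by apply: (@cvg_norm C H); exact: synthesisP.
apply: (cvgC_le (cvgM nP nP)); apply: nearW => A.
by rewrite /= -expr2 norm_combination ell2_inner_ge.
Qed.

Definition synthesis : hilb_hom (ell2 R X) H :=
  HilbHom synthesis_linear
    (linear_contractive_continuous synthesis_linear synthesis_norm).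

Lemma synthesis_in (M : set H) (phi : ell2 R X) :
  closed_subspace M -> (forall x, M (e x)) -> M (synthesis phi).
Proof.
move=> [M0 MD Mc] Me; apply: (closed_cvg M Mc _ _ (synthesisP (phi := phi))).
apply: nearW => A; rewrite psumE; elim: (A : seq I) => [|x s IHs].
  by rewrite big_nil.
by rewrite big_cons; exact: MD.
Qed.

Lemma inner_synthesis x (phi : ell2 R X) : inner (e x) (synthesis phi) = phi x.
Proof.
have cP : (inner (e x) \o combination phi : _ -> C^o) @ totally -->
    (inner (e x) (synthesis phi) : C^o).
  apply: continuous_cvg; [exact: continuous_inner|exact: synthesisP].
(* The net is constant from the finite set {x} on. *)
apply: (cvgC_unique cP); apply: cvg_near_cst; exists [fset (x : I)]%fset => //= A xA.
by rewrite inner_combination // (fsubsetP xA) // inE.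
Qed.

Lemma orthogonal_residue h x : inner (e x) (h - synthesis (analysis h)) = 0.
Proof. by rewrite innerBr inner_synthesis subrr. Qed.

(** For an orthonormal family of elements of a closed subspace [S], this says that
    the family is an orthonormal basis of [S] ([synthesis_analysis]). *)
Definition total_in (S : set H) : Prop :=
  forall y, S y -> (forall x, inner (e x) y = 0) -> y = 0.

(** The error of the Fourier expansion of a vector of [M] lies in [M] and is
    orthogonal to the family. *)
Lemma synthesis_analysis (M : set H) (h : H) : closed_subspace M ->
  (forall x, M (e x)) -> total_in M -> M h -> synthesis (analysis h) = h.
Proof.
move=> Mcs Me Mt Mh; apply/esym/eqP; rewrite -subr_eq0; apply/eqP.
apply: Mt; last exact: orthogonal_residue.
have [M0 MD _] := Mcs.
by rewrite addrC -scaleN1r; apply: MD => //; exact: synthesis_in.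
Qed.

End Orthonormal.

(** * Orthonormal bases and orthogonal complements *)

Section Bases.
Variables (R : realType) (H : hilbertType R).
Local Notation C := R[i].

(** A maximal orthonormal subset of [S], given by Zorn's lemma, is total in [S]: a
    nonzero element of [S] orthogonal to it could be normalized and added. *)
Lemma maximal_orthonormal (S : set H) :
  (forall (a : C) x, S x -> S (a *: x)) ->
  exists (X : Type) (e : X -> H),
    [/\ orthonormal e, forall x, S (e x) & total_in e S].
Proof.
move=> SZ; pose P (E : set H) := [/\ E `<=` S, forall x, E x -> inner x x = 1 &
  forall x y, E x -> E y -> x <> y -> inner x y = 0].
have [F FP Ftot|E [[ES E1 E0] Emax]] := @Zorn_bigcup H P.
  split=> [x [A /FP[+ _ _]]|x [A /FP[_ + _]]|x y [A FA Ax] [B FB By]];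
    [exact|exact|].
  have [AB|BA] := Ftot _ _ FA FB.
    by have [_ _ +] := FP _ FB; apply => //; exact: AB.
  by have [_ _ +] := FP _ FA; apply => //; exact: BA.
exists {x | E x}, sval; split=> [|[x Ex] /=|y Sy yE]; last 2 first.
- exact: ES.
- apply: contrapT => /eqP y0; pose z := `|y|^-1 *: y.
  have z1 : inner z z = 1.
    rewrite innerZl innerZr inner_norm geC0_conj ?invr_ge0 // mulrA -invfM.
    by rewrite -expr2 mulVf // sqrf_eq0 normr_eq0.
  have Ez x : E x -> inner x z = 0.
    by move=> Ex; rewrite innerZr (yE (exist _ x Ex)) mulr0.
  apply: (Emax (E `|` [set z])).
    split; first exact: subsetUl.
    move=> /(_ z (or_intror erefl)) /Ez; by rewrite z1 => /eqP; rewrite oner_eq0.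
  split=> [x [/ES//|->]|x [/E1//|-> //]|x x' [Ex|->] [Ex'|->] xx'].
  + exact: SZ.
  + exact: E0.
  + exact: Ez.
  + exact/inner_eq0C/Ez.
  + by case: xx'.
split=> [[x Ex] /=|[x Ex] [y Ey] xy /=]; first exact: E1.
by apply: E0 => // xy'; apply: xy; exact: eq_exist.
Qed.

Lemma closed_subspaceZ (M : set H) :
  closed_subspace M -> forall (a : C) x, M x -> M (a *: x).
Proof. by move=> [M0 MD _] a x Mx; rewrite -[_ *: _]addr0; exact: MD. Qed.

(** Every vector of [M] is a convergent sum of multiples of the [e x]. *)
Lemma orthogonal_total (X : Type) (e : X -> H) (M : set H) (y : H) :
  orthonormal e -> closed_subspace M -> (forall x, M (e x)) -> total_in e M ->
  (forall x, inner (e x) y = 0) -> orthocomplement M y.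
Proof.
move=> oe Mcs eM et ey m Mm.
rewrite -(synthesis_analysis oe Mcs eM et Mm); apply: inner_eq0C.
have : orthocomplement [set y] (synthesis oe (analysis oe m)); last exact.
apply: synthesis_in => [|x _ ->]; first exact: closed_subspace_orthocomplement.
exact: inner_eq0C.
Qed.

(** The error of the Fourier expansion of [h] with respect to an orthonormal basis
    of [M] is orthogonal to [M], hence zero; so [h] is its expansion, which lies
    in [M]. *)
Lemma closed_subspace_full (M : set H) :
  closed_subspace M -> orthocomplement M `<=` [set 0] -> forall h, M h.
Proof.
move=> Mcs Mperp h.
have [X [e [oe eM et]]] := maximal_orthonormal (closed_subspaceZ Mcs).
have -> : h = synthesis oe (analysis oe h); last exact: synthesis_in.
apply/eqP; rewrite -subr_eq0; apply/eqP; apply: Mperp.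
by apply: (orthogonal_total oe Mcs eM et); exact: orthogonal_residue.
Qed.

End Bases.

Definition sum_family (X Y T : Type) (d : X -> T) (e : Y -> T)
    (z : (X + Y)%type) : T :=
  match z with inl x => d x | inr y => e y end.

Lemma orthonormal_sum_family (R : realType) (H : hilbertType R) (X Y : Type)
    (d : X -> H) (e : Y -> H) :
  orthonormal d -> orthonormal e -> (forall x y, inner (d x) (e y) = 0) ->
  orthonormal (sum_family d e).
Proof.
move=> [d1 d0] [e1 e0] de; split=> [[x|y] //=|[x|y] [x'|y'] //= zz'].
- by apply: d0 => xx'; apply: zz'; rewrite xx'.
- exact/inner_eq0C/de.
- by apply: e0 => yy'; apply: zz'; rewrite yy'.
Qed.

(** The orthogonal direct sum of a closed subspace and its orthogonal complement
    is the whole space, in terms of bases. *)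
Lemma total_sum_family (R : realType) (H : hilbertType R) (X Y : Type)
    (d : X -> H) (e : Y -> H) (M : set H) :
  orthonormal d -> closed_subspace M -> (forall x, M (d x)) -> total_in d M ->
  total_in e (orthocomplement M) -> total_in (sum_family d e) setT.
Proof.
move=> od Mcs Md dt et h _ h0; apply: et => [|y]; last exact: (h0 (inr y)).
by apply: (orthogonal_total od Mcs Md dt) => x; exact: (h0 (inl x)).
Qed.

(** * Monic and epic continuous linear maps *)

Section Homs.
Variables (R : realType) (H K : hilbertType R).
Implicit Types f g : hilb_hom H K.

Lemma closed_subspace_equalizer (f g : H -> K) :
  linear f -> linear g -> continuous f -> continuous g ->
  closed_subspace [set h | f h = g h].
Proof.
move=> fl gl fc gc; split=> [|a x y /= fgx fgy|]; last exact: closed_equalizer.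
  have l0 (k : H -> K) : linear k -> k 0 = 0.
    by move=> kl; have := kl (-1) 0 0; rewrite !scaleN1r oppr0 addr0 addNr.
  by rewrite /= !l0.
by rewrite fl gl fgx fgy.
Qed.

Definition kernel f : set H := [set h | f h = 0].

Lemma closed_subspace_kernel f : closed_subspace (kernel f).
Proof.
apply: (@closed_subspace_equalizer f (fun=> 0)).
- exact: hilb_linear.
- by move=> a x y; rewrite scaler0 addr0.
- exact: hilb_continuous.
- exact: cst_continuous.
Qed.

(** The equalizer of [f] and [g] is a closed subspace containing the family, so its
    orthogonal complement is zero. *)
Lemma hilb_eq_total (X : Type) (e : X -> H) f g :
  total_in e setT -> (forall x, f (e x) = g (e x)) -> f = g.
Proof.
move=> et fg; apply: hilb_ext; apply: (@closed_subspace_full _ _ [set h | f h = g h]).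
  apply: closed_subspace_equalizer; by [exact: hilb_linear|exact: hilb_continuous].
by move=> y My; apply: et => // x; exact/My/fg.
Qed.

Lemma hilb_hom0 f : f 0 = 0.
Proof. by have [] := closed_subspace_kernel f. Qed.

Lemma hilb_homB f x y : f (x - y) = f x - f y.
Proof. by rewrite addrC -scaleN1r hilb_linear scaleN1r addrC. Qed.

Program Definition hilb_add f g : hilb_hom H K := @HilbHom _ H K (f \+ g) _ _.
Next Obligation.
by move=> f g a x y /=; rewrite !hilb_linear scalerDr addrACA.
Qed.
Next Obligation.
by move=> f g x; apply: cvgD; exact: hilb_continuous.
Qed.

Lemma hilb_monic f : (forall h, f h = 0 -> h = 0) -> @Defs.monic (Hilb R) H K f.
Proof.
move=> f0 Z g1 g2 fg; apply: hilb_ext => z.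
apply/eqP; rewrite -subr_eq0; apply/eqP.
apply: f0; rewrite hilb_homB; apply/eqP; rewrite subr_eq0; apply/eqP.
exact: (congr1 (fun k : hilb_hom Z K => k z) fg).
Qed.

End Homs.

(** Totality of [f] in the whole space is the density of its range, in the form of
    a zero orthogonal complement. *)
Lemma hilb_epic (R : realType) (H K : hilbertType R) (f : hilb_hom H K) :
  total_in f setT -> @epic (Hilb R) H K f.
Proof.
move=> ft Z g1 g2 gf; apply: (hilb_eq_total ft) => h.
exact: (congr1 (fun k : hilb_hom H Z => k h) gf).
Qed.

Lemma analysis_bimorphism (R : realType) (H : hilbertType R) (X : Type)
    (e : X -> H) (oe : orthonormal e) :
  total_in e setT -> @bimorphism (Hilb R) H (ell2 R X) (analysis oe).
Proof.
move=> et; split.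
  apply: hilb_monic => h h0; apply: et => // x.
  exact: (congr1 (fun phi : ell2 R X => phi x) h0).
(* The analysis map is onto, so phi is orthogonal to itself. *)
apply: hilb_epic => phi _ phi0; apply: inner_eq0.
rewrite -[X in inner X _](_ : analysis oe (synthesis oe phi) = phi) //.
by apply: ell2_eqP; apply/funext => x; exact: inner_synthesis.
Qed.

(** * The factorization *)

Section SumPinj.
Variables (X Y : Type).

Program Definition pinj_inl : pinj X (X + Y)%type :=
  @Defs.Pinj X (X + Y)%type (fun x z => z = inl x) _ _.
Next Obligation. by move=> x y y' -> ->. Qed.
Next Obligation. by move=> x x' y -> []. Qed.

Program Definition pinj_inr : pinj Y (X + Y)%type :=
  @Defs.Pinj Y (X + Y)%type (fun y z => z = inr y) _ _.
Next Obligation. by move=> x y y' -> ->. Qed.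
Next Obligation. by move=> x x' y -> []. Qed.

Definition pinj_dagger (f : pinj X Y) : pinj Y X :=
  @Defs.Pinj _ _ (fun y x => f x y)
    (fun y x x' => @pinj_injective _ _ f x x' y)
    (fun y y' x => @pinj_functional _ _ f x y y').

End SumPinj.

Section Adjoints.
Variables (R : realType) (X Y : Type).

(** The adjoints of the two isometric inclusions into [ell2 R (X + Y)]: they
    restrict a family to one summand. *)
Definition ell2_inl_adjoint : hilb_hom (ell2 R (X + Y)%type) (ell2 R X) :=
  ell2_hom R (pinj_dagger (pinj_inl X Y)).

Definition ell2_inr_adjoint : hilb_hom (ell2 R (X + Y)%type) (ell2 R Y) :=
  ell2_hom R (pinj_dagger (pinj_inr X Y)).

Lemma ell2_inl_adjointE phi x : ell2_inl_adjoint phi x = phi (inl x).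
Proof. exact: ell2_map_fun_in. Qed.

Lemma ell2_inr_adjointE phi y : ell2_inr_adjoint phi y = phi (inr y).
Proof. exact: ell2_map_fun_in. Qed.

End Adjoints.

Definition middle_pinj (A B D : Type) : pinj (A + B)%type (B + D)%type :=
  pinj_comp (pinj_inl B D) (pinj_dagger (pinj_inr A B)).

Section Factorization.
Variables (R : realType) (H K : hilbertType R) (g : hilb_hom H K).
Variables (A B D : Type) (eA : A -> H) (eB : B -> H) (eD : D -> K).
Hypotheses (oA : orthonormal eA) (oB : orthonormal eB) (oD : orthonormal eD).
Hypotheses (kA : forall a, kernel g (eA a)) (tA : total_in eA (kernel g)).
Hypotheses (kB : forall b, orthocomplement (kernel g) (eB b))
  (tB : total_in eB (orthocomplement (kernel g))).
Hypotheses (gD : forall d, orthocomplement (range g) (eD d))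
  (tD : total_in eD (orthocomplement (range g))).

Definition assemble : hilb_hom (ell2 R (B + D)%type) K :=
  hilb_add (hilb_comp g (hilb_comp (synthesis oB) (ell2_inl_adjoint R B D)))
           (hilb_comp (synthesis oD) (ell2_inr_adjoint R B D)).

Lemma assembleE phi : assemble phi =
  g (synthesis oB (ell2_inl_adjoint R B D phi)) +
  synthesis oD (ell2_inr_adjoint R B D phi).
Proof. by []. Qed.

Lemma orthonormal_domain : orthonormal (sum_family eA eB).
Proof. by apply: orthonormal_sum_family => // a b; exact/kB/kA. Qed.

Lemma total_domain : total_in (sum_family eA eB) setT.
Proof.
exact: (total_sum_family oA (closed_subspace_kernel g) kA tA tB).
Qed.

Lemma assemble_factor (oAB : orthonormal (sum_family eA eB)) :
  g = hilb_comp assemble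
        (hilb_comp (ell2_hom R (middle_pinj A B D)) (analysis oAB)).
Proof.
apply: (hilb_eq_total total_domain) => x; set h := sum_family _ _ x => /=.
set psi := ell2_map (middle_pinj A B D) _.
have psil b : psi (inl b) = inner (eB b) h.
  by rewrite /psi /= (@ell2_map_fun_in _ _ _ _ _ (inr b)) //; exists b.
have psir d : psi (inr d) = 0.
  by rewrite /psi /= ell2_map_fun_notin // => z [b [_ /=]].
rewrite -[RHS]/(assemble psi) assembleE.
have -> : ell2_inr_adjoint R B D psi = 0.
  by apply: ell2_eqP; apply/funext => d; rewrite ell2_inr_adjointE psir.
rewrite (hilb_hom0 (synthesis oD)) addr0.
have -> : ell2_inl_adjoint R B D psi = analysis oB h.
  by apply: ell2_eqP; apply/funext => b; rewrite ell2_inl_adjointE psil.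
case: x @h psi psil psir => [a|b] h psi psil psir.
  have -> : analysis oB h = 0.
    by apply: ell2_eqP; apply/funext => b; exact/inner_eq0C/kB/kA.
  by rewrite (hilb_hom0 (synthesis oB)) hilb_hom0; exact: kA.
rewrite (synthesis_analysis oB _ kB tB) //; last exact: kB.
exact: closed_subspace_orthocomplement.
Qed.

Lemma assemble_monic : @Defs.monic (Hilb R) (ell2 R (B + D)%type) K assemble.
Proof.
apply: hilb_monic => phi; rewrite assembleE.
set s := synthesis oB _; set l := synthesis oD _ => gsl.
have gs_l : inner (g s) l = 0.
  have lP : orthocomplement (range g) l.
    by apply: synthesis_in => //; exact: closed_subspace_orthocomplement.
  by apply: lP; exists s.
have l0 : l = 0.
  apply: inner_eq0; have := inner0r l.
  by rewrite -gsl innerDr (inner_eq0C gs_l) add0r.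
have s0 : s = 0.
  apply: inner_eq0; have : orthocomplement (kernel g) s.
    by apply: synthesis_in => //; exact: closed_subspace_orthocomplement.
  by apply; move: gsl; rewrite l0 addr0.
apply: ell2_eqP; apply/funext => -[b|d].
  by rewrite -ell2_inl_adjointE -(inner_synthesis oB) -/s s0 inner0r.
by rewrite -ell2_inr_adjointE -(inner_synthesis oD) -/l l0 inner0r.
Qed.

Lemma assemble_epic : @epic (Hilb R) (ell2 R (B + D)%type) K assemble.
Proof.
have range_g h : exists phi, assemble phi = g h.
  have oAB := orthonormal_domain.
  exists (ell2_hom R (middle_pinj A B D) (analysis oAB h)).
  by have /(congr1 (fun k : hilb_hom H K => k h)) := assemble_factor oAB.
have range_eD d : exists phi, assemble phi = eD d.
  pose chi := ell2_hom R (pinj_inr B D) (analysis oD (eD d)); exists chi.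
  have chil : ell2_inl_adjoint R B D chi = 0.
    apply: ell2_eqP; apply/funext => b.
    by rewrite ell2_inl_adjointE /= ell2_map_fun_notin.
  have chir : ell2_inr_adjoint R B D chi = analysis oD (eD d).
    apply: ell2_eqP; apply/funext => d'.
    by rewrite ell2_inr_adjointE /= (@ell2_map_fun_in _ _ _ _ _ d').
  rewrite assembleE chil chir (hilb_hom0 (synthesis oB)) hilb_hom0 add0r.
  apply: (synthesis_analysis oD _ gD tD); last exact: gD.
  exact: closed_subspace_orthocomplement.
apply: hilb_epic => y _ y0; apply: tD => [_ [h _ <-]|d].
  by have [phi <-] := range_g h.
by have [phi <-] := range_eD d.
Qed.

End Factorization.

Theorem theorem5p11 (R : realType) : essentially_full (ell2_functor R).
Proof.
move=> H K g.
have [A [eA [oA kA tA]]] :=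
  maximal_orthonormal (closed_subspaceZ (closed_subspace_kernel g)).
have [B [eB [oB kB tB]]] := maximal_orthonormal
  (closed_subspaceZ (closed_subspace_orthocomplement (kernel g))).
have [D [eD [oD gD tD]]] := maximal_orthonormal (closed_subspaceZ
  (closed_subspace_orthocomplement (range (g : hilb_hom H K)))).
have oAB := orthonormal_domain oA oB kA kB.
exists (A + B)%type, (B + D)%type, (middle_pinj A B D), (analysis oAB).
exists (assemble g oB oD); split.
- exact: (analysis_bimorphism oAB (total_domain oA kA tA tB)).
- split; first exact: (assemble_monic kB gD).
  exact: (assemble_epic oA kA tA kB tB gD tD).
- exact: assemble_factor.
Qed.
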